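(* Let $\Gamma$ be a finitely generated abelian group with an injective endomorphism $F$. Suppose $\Gamma$ admits a function $h:\Gamma\to[0,\infty)$ satisfying: (1) for some $D>1$ and $\kappa>0$, $h(-a)\le Dh(a)+\kappa$ and $h(a+b)\le D(h(a)+h(b))+\kappa$ for all $a,b\in\Gamma$; (2) (Northcott property) for every $N$ there are only finitely many $a\in\Gamma$ such that $h(a)\le N$; (3) (canonicity) for some $C>1$, $h(F(a))\ge Ch(a)$ for all $a\in\Gamma$ outside of a finite set. Then, for some integer $r>0$, $\Gamma$ has an $F^r$-spanning set.
   Context: Let $\Gamma$ be a finitely generated abelian group and $F$ an endomorphism of $\Gamma$. For a finite word $x_0x_1\cdots x_m$ with letters in $\Gamma$ put $[x_0x_1\cdots x_m]_F:=x_0+Fx_1+\cdots+F^mx_m$. A finite subset $\Sigma\subseteq\Gamma$ is an $F$-spanning set for $\Gamma$ if: (i) $0\in\Sigma$ and $x\in\Sigma\Rightarrow -x\in\Sigma$; (ii) for $x\in\Gamma$, $Fx\in\Sigma\Rightarrow x\in\Sigma$; (iii) every $x\in\Gamma$ equals $[x_0\cdots x_m]_F$ for some $m\ge 0$ and $x_0,\dots,x_m\in\Sigma$; (iv) for all $x_1,\dots,x_5\in\Sigma$ there are $t,t'\in\Sigma$ with $x_1+\cdots+x_5=t+Ft'$; (v) if $x_1,x_2,x_3\in\Sigma$ and $x_1+x_2+x_3\in F(\Gamma)$ then there is $t\in\Sigma$ with $x_1+x_2+x_3=Ft$. An $F^r$-spanning set is defined by replacing $F$ by $F^r$ throughout.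 *)

(* Defs.v *)
From HB Require Import structures.
From mathcomp Require Import all_boot all_order all_algebra.
From mathcomp Require Import all_classical reals.

Set Implicit Arguments.
Unset Strict Implicit.
Unset Printing Implicit Defensive.

Import GRing.Theory.
Local Open Scope classical_set_scope.
Local Open Scope ring_scope.

Definition finitely_generated (G : zmodType) : Prop :=
  exists (n : nat) (g : 'I_n -> G),
    forall x : G, exists c : 'I_n -> int, x = \sum_(i < n) g i *~ c i.

(* [x_0 x_1 ... x_m]_F.  Here and below F is a bare function rather than an
   {additive G -> G}, so that the definitions apply directly to iter r F. *)
Definition word_value (G : zmodType) (F : G -> G) (w : seq G) : G :=
  \sum_(i < size w) iter i F w`_i.

Record spanning_set (G : zmodType) (F : G -> G) (S : set G) : Prop := {
  spanning_finite : finite_set S;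
  spanning_0 : S 0;
  spanning_opp : forall x, S x -> S (- x);
  spanning_pre : forall x, S (F x) -> S x;
  spanning_word : forall x, exists w : seq G,
    [/\ (0 < size w)%N, (forall y, y \in w -> S y) & x = word_value F w];
  spanning_sum5 : forall x1 x2 x3 x4 x5,
    S x1 -> S x2 -> S x3 -> S x4 -> S x5 ->
    exists t t', [/\ S t, S t' & x1 + x2 + x3 + x4 + x5 = t + F t'];
  spanning_sum3 : forall x1 x2 x3,
    S x1 -> S x2 -> S x3 -> range F (x1 + x2 + x3) ->
    exists2 t, S t & x1 + x2 + x3 = F t
}.

(* Main.v *)
Require Import Defs.
From HB Require Import structures.
From mathcomp Require Import all_boot all_order all_algebra.
From mathcomp Require Import all_classical reals.
From mathcomp Require Import lra.

Set Implicit Arguments.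
Unset Strict Implicit.
Unset Printing Implicit Defensive.

Import Order.TTheory GRing.Theory Num.Theory.
Local Open Scope classical_set_scope.
Local Open Scope ring_scope.

(** The spanning set is a ball for the symmetrized height, of a radius chosen large
    after [r].

    Replacing [h a] by the maximum of [h a] and [h (- a)] gives a symmetric
    height with the same three properties, so balls become symmetric.  For this
    height, adding two elements of height at most [M] gives height at most
    [K * M], with [K = 2 * D + 1], as soon as [M >= kappa]: a sum of six elements
    of the ball of radius [N] has height at most [K ^+ 5 * N].

    Canonicity multiplies large heights by [C > 1] at each application of [F],
    hence by [C ^+ r] for the [r]-th iterate [Phi].  Choose [r] with
    [K ^+ 5 <= C ^+ r].  Then [Phi y] can be a sum of at most six elements of the
    ball only if [y] is in the ball.  This gives the preimage condition, the
    condition on sums of three, and also the condition on sums of five once one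
    can write [x1 + ... + x5 = t + Phi y] with [t] in the ball.

    Such a [t] exists because [Phi G] has finite index in [G]: [r] being fixed,
    [N] can be taken large enough for the ball to contain representatives of all
    cosets.  Finite index (lemma [finite_coset_reps]) comes from finite
    generation and injectivity: by Cayley-Hamilton [Phi] is annihilated by an
    integer polynomial, whose constant coefficient may be assumed nonzero after
    cancelling powers of [Phi].  So a nonzero multiple of [G] lies in [Phi G].

    Finally, writing [x = t + Phi y] at least halves the height as long as [y] is
    outside the ball, so repeating this step spells [x] as a word. *)

(** * The image of an injective endomorphism has finite index *)

Lemma iter_inj (T : Type) (f : T -> T) (r : nat) :
  injective f -> injective (iter r f).
Proof. by move=> f_inj; elim: r => // r IHr x y /f_inj/IHr. Qed.

Section FiniteIndex.

Variables (G : zmodType) (F : {additive G -> G}).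

Lemma iter_is_zmod_morphism (r : nat) : zmod_morphism (iter r F).
Proof. by elim: r => [|r IHr] x y //=; rewrite IHr raddfB. Qed.

HB.instance Definition _ (r : nat) :=
  GRing.isZmodMorphism.Build G G (iter r F) (iter_is_zmod_morphism r).

(** Lift [F] to an integer matrix [A] along a surjection [phi] from row vectors,
    and let [q * 'X ^+ k] be the characteristic polynomial of [A], with
    [q.[0] != 0].  Cayley-Hamilton and the injectivity of the [k]-th iterate of
    [F] show that [q], evaluated at [A], is killed by [phi]; isolating its
    constant coefficient expresses [q.[0]] times any element as a value of [F]. *)
Lemma multiple_in_range : finitely_generated G -> injective F ->
  exists2 c : int, c != 0 & forall x, exists y, x *~ c = F y.
Proof.
move=> [[|n] [g g_gen]] F_inj.
  exists 1 => // x; exists 0.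
  by have [c ->] := g_gen x; rewrite big_ord0 mul0rz raddf0.
have /choice[coef coefE] := g_gen.
have /choice[a Fg] := fun i => g_gen (F (g i)).
pose A : 'M[int]_n.+1 := \matrix_(i, j) a i j.
pose phi (v : 'rV[int]_n.+1) : G := \sum_i g i *~ v 0 i.
have phiD u v : phi (u + v) = phi u + phi v.
  by rewrite -big_split; apply: eq_bigr => i _; rewrite mxE mulrzDr.
have phi_mul v : phi (v *m A) = F (phi v).
  rewrite raddf_sum /phi.
  under eq_bigr => j _.
    rewrite mxE mulrz_sumr.
    under eq_bigr => i _ do rewrite mxE mulrC mulrzA.
    over.
  rewrite exchange_big; apply: eq_bigr => i _ /=.
  by rewrite raddfMz Fg mulrz_suml.
have phi_mulX k v : phi (v *m A ^+ k) = iter k F (phi v).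
  elim: k v => [|k IHk] v; first by rewrite expr0 mulmx1.
  by rewrite exprSr mulmxA phi_mul IHk.
have phi_scalar v (c : int) : phi (v *m c%:M) = phi v *~ c.
  rewrite mul_mx_scalar /phi mulrz_suml; apply: eq_bigr => i _.
  by rewrite mxE mulrC mulrzA.
have [k [q q0 Pq]] := multiplicity_XsubC (char_poly A) 0.
rewrite subr0 in Pq.
have {}q0 : ~~ root q 0 by apply: (implyP q0); exact/monic_neq0/char_poly_monic.
have phi_q v : phi (v *m horner_mx A q) = 0.
  have Fk_inj : injective (iter k F) by exact: iter_inj.
  apply: Fk_inj; rewrite raddf0 -phi_mulX -mulmxA.
  have -> : horner_mx A q *m A ^+ k = 0.
    by rewrite -(Cayley_Hamilton A) Pq rmorphM rmorphXn /= horner_mx_X.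
  by rewrite mulmx0 /phi big1 // => i _; rewrite mxE mulr0z.
have [p Ep] : exists p, q - q.[0]%:P = p * ('X - 0%:P).
  by apply/factor_theorem; rewrite rootE !hornerE subrr.
have {}Ep : q = p * 'X + q.[0]%:P.
  by rewrite -[in LHS](subrK q.[0]%:P q) Ep subr0.
exists q.[0] => // x; exists (- phi ((\row_i coef x i) *m horner_mx A p)).
have {1}-> : x = phi (\row_i coef x i).
  by rewrite [LHS]coefE; apply: eq_bigr => i _; rewrite mxE.
rewrite raddfN -phi_mul -mulmxA -phi_scalar; apply/eqP; rewrite -addr_eq0 -phiD.
rewrite -mulmxDr -(phi_q (\row_i coef x i)) [in X in _ == X]Ep.
by rewrite rmorphD rmorphM /= horner_mx_X horner_mx_C addrC.
Qed.

(** With [c] as in [multiple_in_range], coefficients on the generators matter only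
    modulo [c], so finitely many combinations of the generators suffice. *)
Lemma finite_coset_reps : finitely_generated G -> injective F ->
  exists2 T : set G, finite_set T &
    forall x, exists t y, T t /\ x = t + F y.
Proof.
move=> G_fg F_inj; have [c c0 cF] := multiple_in_range G_fg F_inj.
have [n [g g_gen]] := G_fg.
pose rep (f : {ffun 'I_n -> 'I_`|c|.+1}) : G := \sum_i g i *+ f i.
exists (range rep); first exact/finite_image/finite_finset.
move=> x; have [a ->] := g_gen x; have /choice[b bE] := fun i => cF (g i).
exists (rep [ffun i => inord `|(a i %% c)%Z|]), (\sum_i b i *~ (a i %/ c)%Z).
split; first by exists [ffun i => inord `|(a i %% c)%Z|].
rewrite raddf_sum -big_split; apply: eq_bigr => i _ /=.
have a_ge0 : 0 <= (a i %% c)%Z by exact: modz_ge0.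
have a_lt : (`|(a i %% c)%Z| < `|c|.+1)%N.
  by rewrite ltnS -lez_nat gez0_abs // ltW // ltz_mod.
rewrite ffunE inordK // raddfMz -bE -mulrzA pmulrn gez0_abs // -mulrzDr.
by rewrite [in LHS](divz_eq (a i) c) addrC mulrC.
Qed.

End FiniteIndex.

(** * Auxiliary bounds *)

Lemma finite_set_ubound (R : realDomainType) (T : choiceType) (f : T -> R)
    (A : set T) :
  finite_set A -> exists2 M, 0 <= M & forall a, A a -> f a <= M.
Proof.
move=> /finite_seqP[s ->]; exists (\sum_(a <- s) `|f a|) => [|a /= sa].
  exact: sumr_ge0.
by rewrite (big_rem a) //= (le_trans (ler_norm _)) // lerDl sumr_ge0.
Qed.

Lemma exists_expr_ge (R : archiRealFieldType) (C M : R) : 1 < C ->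
  exists2 r, (0 < r)%N & M <= C ^+ r.
Proof.
move=> C1.
(* A weak form of Bernoulli's inequality, enough by the Archimedean property. *)
have bern n : n%:R * (C - 1) <= C ^+ n.
  suff : 1 + n%:R * (C - 1) <= C ^+ n by lra.
  elim: n => [|n IHn]; first by rewrite mul0r addr0 expr0.
  have : 0 <= n%:R * (C - 1) * (C - 1) by rewrite !mulr_ge0 ?ler0n ?subr_ge0 ?ltW.
  have : C * (1 + n%:R * (C - 1)) <= C ^+ n.+1.
    by rewrite exprS ler_wpM2l // (le_trans ler01) ?ltW.
  by rewrite -natr1; lra.
have C1_gt0 : 0 < C - 1 by rewrite subr_gt0.
have M_ge0 : 0 <= `|M| / (C - 1) by rewrite divr_ge0 ?normr_ge0 ?ltW.
exists (Num.bound (`|M| / (C - 1))).+1 => //.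
rewrite (le_trans _ (bern _)) // (le_trans (ler_norm M)) // -ler_pdivrMr //.
by rewrite -natr1 (le_trans (ltW (archi_boundP M_ge0))) // lerDl.
Qed.

(** * Balls of an expanding height *)

Section HeightBall.

Variables (R : archiRealFieldType) (G : zmodType) (F : {additive G -> G}).
Variables (h : G -> R) (K N : R) (T : set G).
Hypotheses (K_ge2 : 2 <= K) (N_gt0 : 0 < N).
Hypothesis h_opp : forall a, h (- a) = h a.
Hypothesis h_add : forall a b M, N <= M -> h a <= M -> h b <= M ->
  h (a + b) <= K * M.
Hypothesis h_finite : forall M, finite_set [set a | h a <= M].
Hypothesis h_expand : forall a, N < h a -> K ^+ 5 * h a <= h (F a).
Hypothesis T_small : forall t, T t -> h t <= N.
Hypothesis T_reps : forall x, exists t y, T t /\ x = t + F y.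

Let ball : set G := [set a | h a <= N].

Let K_ge1 : 1 <= K. Proof. by rewrite (le_trans _ K_ge2) ?ler1n. Qed.
Let K_gt0 : 0 < K. Proof. exact: lt_le_trans K_ge1. Qed.

Lemma sum_in_ball_bound (k : nat) (a b : G) :
  h a <= K ^+ k * N -> h b <= N -> h (a + b) <= K ^+ k.+1 * N.
Proof.
move=> ha hb; have N_le : N <= K ^+ k * N.
  by rewrite ler_peMl ?exprn_ege1 // ltW.
by rewrite exprS -mulrA h_add // (le_trans hb).
Qed.

(** The expansion factor [K ^+ 5] outside the ball beats the growth of the height
    in sums of at most six elements of the ball. *)
Lemma ball_preimage (k : nat) (y : G) : (k <= 5)%N ->
  h (F y) <= K ^+ k * N -> ball y.
Proof.
move=> k5 hFy; rewrite /ball /= leNgt; apply/negP => y_big.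
have : K ^+ 5 * h y <= K ^+ 5 * N.
  rewrite (le_trans (h_expand y_big)) // (le_trans hFy) //.
  by rewrite ler_pM2r // ler_weXn2l.
by rewrite ler_pM2l ?exprn_gt0 // leNgt y_big.
Qed.

(** Induction on the number of doublings from [N] to [h x].  For [x = t + F y] and
    [y] outside the ball, [K ^+ 5 * h y <= h (F y) = h (x - t)], which loses only
    one factor [K]; the remaining [K ^+ 4 >= 2] gains one doubling. *)
Lemma ball_word (x : G) : exists w : seq G,
  [/\ (0 < size w)%N, (forall y, y \in w -> ball y) & x = word_value F w].
Proof.
have [n] : exists n, h x <= 2 ^+ n * N.
  have [n _ n_big] : exists2 n, (0 < n)%N & h x / N <= 2 ^+ n.
    by apply: exists_expr_ge; lra.
  by exists n; rewrite -ler_pdivrMr.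
elim: n x => [|n IHn] x hx.
  exists [:: x]; split=> //; last by rewrite /word_value big_ord1.
  by move=> y; rewrite inE => /eqP ->; move: hx; rewrite expr0 mul1r.
have [t [y [Tt xE]]] := T_reps x.
have [|w [w_gt0 w_ball yE]] := IHn y.
  have N_le k : N <= 2 ^+ k * N.
    by rewrite ler_peMl ?exprn_ege1 ?ltW ?ltr1n.
  have [y_small|y_big] := lerP (h y) N; first exact: le_trans y_small _.
  have hFy : h (F y) <= K * (2 ^+ n.+1 * N).
    have -> : F y = x + - t by rewrite xE addrC addKr.
    by rewrite h_add ?h_opp // (le_trans (T_small Tt)).
  have K4_ge2 : 2 <= K ^+ 4.
    by rewrite (le_trans K_ge2) // exprS ler_peMr ?exprn_ege1 ?(ltW K_gt0).
  have : K * (K ^+ 4 * h y) <= K * (2 ^+ n.+1 * N).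
    by rewrite mulrA -exprS (le_trans (h_expand y_big)).
  rewrite ler_pM2l // => K4y.
  have hy_ge0 : 0 <= h y by rewrite ltW // (lt_trans N_gt0).
  have : 2 * h y <= 2 * (2 ^+ n * N).
    by rewrite mulrA -exprS (le_trans _ K4y) // ler_wpM2r.
  by rewrite ler_pM2l.
exists (t :: w); split=> //.
  by move=> z; rewrite inE => /orP[/eqP ->|/w_ball //]; exact: T_small.
rewrite xE yE /word_value /= big_ord_recl /=; congr (_ + _).
by rewrite raddf_sum.
Qed.

Lemma ball_spanning : h 0 <= N -> spanning_set F ball.
Proof.
move=> h0; split=> //.
- exact: h_finite.
- by move=> x; rewrite /ball /= h_opp.
- by move=> x Fx; apply: (@ball_preimage 0) => //; rewrite expr0 mul1r.
- exact: ball_word.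
- move=> x1 x2 x3 x4 x5 x1N x2N x3N x4N x5N.
  have [t [y [Tt xE]]] := T_reps (x1 + x2 + x3 + x4 + x5).
  exists t, y; split=> //; first exact: T_small.
  apply: (@ball_preimage 5) => //.
  have -> : F y = x1 + x2 + x3 + x4 + x5 - t by rewrite xE addrC addKr.
  have tN : h (- t) <= N by rewrite h_opp T_small.
  by do 5![apply: sum_in_ball_bound => //]; rewrite expr0 mul1r.
- move=> x1 x2 x3 x1N x2N x3N [t _ tE]; exists t => //.
  apply: (@ball_preimage 2) => //; rewrite tE.
  by do 2![apply: sum_in_ball_bound => //]; rewrite expr0 mul1r.
Qed.

End HeightBall.

(** Beyond a nonnegative threshold the height increases under [F], so the orbit
    stays in the region where the expansion inequality holds. *)
Lemma iter_expand (R : realDomainType) (G : Type) (F : G -> G) (h : G -> R)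
    (C M : R) :
  1 < C -> 0 <= M -> (forall a, M < h a -> C * h a <= h (F a)) ->
  forall r a, M < h a -> C ^+ r * h a <= h (iter r F a).
Proof.
move=> C1 M0 hF r a aM; have a0 : 0 <= h a by rewrite (le_trans M0) ?ltW.
elim: r => [|r IHr]; first by rewrite expr0 mul1r.
have aM' : M < h (iter r F a).
  by rewrite (lt_le_trans aM) // (le_trans _ IHr) // ler_peMl ?exprn_ege1 ?(ltW C1).
rewrite iterS (le_trans _ (hF _ aM')) // exprS -mulrA ler_wpM2l //.
by rewrite (le_trans ler01) ?ltW.
Qed.

Theorem proposition5p8 (R : realType) (G : zmodType) (F : {additive G -> G})
    (h : G -> R)
    (G_fg : finitely_generated G)
    (F_inj : injective F)
    (h_ge0 : forall a : G, 0 <= h a)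
    (h_quasi : exists D kappa : R,
      [/\ 1 < D, 0 < kappa,
          (forall a : G, h (- a) <= D * h a + kappa) &
          (forall a b : G, h (a + b) <= D * (h a + h b) + kappa)])
    (h_northcott : forall N : R, finite_set [set a : G | h a <= N])
    (h_canonical : exists2 C : R, 1 < C &
      exists2 E : set G, finite_set E &
        forall a : G, ~ E a -> C * h a <= h (F a)) :
  exists2 r : nat, (0 < r)%N & exists S : set G, spanning_set (iter r F) S.
Proof.
have [D [kappa [D1 kappa0 _ hD]]] := h_quasi.
have [C C1 [E E_fin hE]] := h_canonical.
pose H a := Num.max (h a) (h (- a)).
have H_opp a : H (- a) = H a by rewrite /H opprK maxC.
have H_add a b M : kappa <= M -> H a <= M -> H b <= M ->
    H (a + b) <= (2 * D + 1) * M.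
  rewrite /H !ge_max opprD => kM /andP[aM a'M] /andP[bM b'M].
  have bound u v : h u <= M -> h v <= M -> h (u + v) <= (2 * D + 1) * M.
    move=> uM vM; rewrite (le_trans (hD u v)) //.
    have : D * (h u + h v) <= D * (M + M) by rewrite ler_wpM2l ?lerD //; lra.
    by lra.
  by rewrite !bound.
have H_finite M : finite_set [set a | H a <= M].
  apply: sub_finite_set (h_northcott M) => a /=.
  by rewrite /H ge_max => /andP[].
(* Above height M both a and - a avoid E, since H is symmetric. *)
have [M M_ge0 H_E] := finite_set_ubound H E_fin.
have H_expand a : M < H a -> C * H a <= H (F a).
  move=> aM.
  have notE b : H b = H a -> ~ E b.
    by move=> ba /H_E; rewrite ba leNgt aM.
  rewrite {1}/H maxr_pMr; last by lra.
  rewrite ge_max !le_max (hE _ (notE a erefl)) /=; apply/orP; right; rewrite -raddfN.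
  exact: hE (notE _ (H_opp a)).
(* r is fixed before N: the coset representatives, hence N, depend on r. *)
have [r r_gt0 Cr] := exists_expr_ge ((2 * D + 1) ^+ 5) C1.
have Fr_inj : injective (iter r F) by exact: iter_inj.
have [T T_fin T_reps] := finite_coset_reps G_fg Fr_inj.
have [N0 N0_ge0 H_T] := finite_set_ubound H T_fin.
pose N := kappa + M + N0 + H 0.
have [kN MN N0N H0N] : [/\ kappa <= N, M <= N, N0 <= N & H 0 <= N].
  have H0_ge0 : 0 <= H 0 by rewrite le_max h_ge0.
  by split; rewrite /N; lra.
exists r => //; exists [set a | H a <= N].
apply: (@ball_spanning _ _ _ H (2 * D + 1) N T) => //.
- by lra.
- by lra.
- by move=> a b L NL; apply: H_add; exact: le_trans NL.
- move=> a Na; have Ma : M < H a by exact: le_lt_trans Na.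
  rewrite (le_trans _ (iter_expand C1 M_ge0 H_expand r Ma)) // ler_wpM2r //.
  by rewrite ltW // (le_lt_trans M_ge0).
- by move=> t /H_T /le_trans; apply.
Qed.
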